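(* Let $\mathbb{K}$ be an algebraically closed field of characteristic different from $2$, let $D_\infty=\langle a,b \mid a^2=b^2=1\rangle$ be the infinite dihedral group, and let $R=\mathbb{K}D_\infty$ be its group algebra. Then $R$ has exactly six conjugacy classes of involutions, namely those of the elements $1,\,-1,\,a,\,-a,\,b,\,-b$. That is, every involution of $R$ is conjugate to exactly one of these six elements, and these six elements are pairwise non-conjugate in $R$.
   Context: An involution of $R$ is an element $u\in R$ with $u^2=1$ (in particular $1$ and $-1$ count as involutions). Two elements $r,r'\in R$ are conjugate if $r'=\nu^{-1}r\nu$ for some unit $\nu\in R^\times$. *)

(* Defs.v *)
From HB Require Import structures.
From mathcomp Require Import all_boot all_order all_algebra.
From mathcomp Require Import finmap.
From mathcomp Require Import monalg.

Set Implicit Arguments.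
Unset Strict Implicit.
Unset Printing Implicit Defensive.

Import GRing.Theory.

Local Open Scope fset_scope.
Local Open Scope ring_scope.

(* The ring structure that monalg puts on {malg K[M]} needs M to be a
   monomType, which excludes every nontrivial group. The group algebra is
   therefore an alias of {malg K[G]}, from which it inherits only the module
   structure. *)
Definition group_algebra (K : nzRingType) (G : groupType) : Type :=
  {malg K[G]}.

HB.instance Definition _ (K : nzRingType) (G : groupType) :=
  GRing.Lmodule.copy (group_algebra K G) {malg K[G]}.

Section GroupAlgebra.
Context (K : nzRingType) (G : groupType).
Implicit Types (f : group_algebra K G) (g h k : G).

Definition of_group g : group_algebra K G := << g >>.

Definition galg_mul f1 f2 : group_algebra K G :=
  \sum_(g <- msupp f1) \sum_(h <- msupp f2) << f1@_g * f2@_h *g (g * h)%g >>.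

Lemma galg_mulw (d1 d2 : {fset G}) f1 f2 :
  msupp f1 `<=` d1 -> msupp f2 `<=` d2 ->
  galg_mul f1 f2 =
    \sum_(g <- d1) \sum_(h <- d2) << f1@_g * f2@_h *g (g * h)%g >>.
Proof.
move=> le1 le2; rewrite /galg_mul (big_fset_incl _ le1) /=.
  apply/eq_bigr => g _; apply/big_fset_incl => // h _ /mcoeff_outdom ->.
  by rewrite mulr0 monalgU0.
move=> g _ /mcoeff_outdom f1g.
by rewrite big1 // => h _; rewrite f1g mul0r monalgU0.
Qed.

Lemma galg_mulUU c d g h :
  galg_mul << c *g g >> << d *g h >> = << c * d *g (g * h)%g >>.
Proof. by rewrite (galg_mulw msuppU_le msuppU_le) !big_seq_fset1 !mcoeffUU. Qed.

Lemma galg_mulDl : left_distributive galg_mul +%R.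
Proof.
move=> f1 f2 f; rewrite [in RHS](galg_mulw (fsubsetUl _ (msupp f2)) (fsubset_refl _)).
rewrite [in RHS](galg_mulw (fsubsetUr (msupp f1) _) (fsubset_refl _)).
rewrite (galg_mulw (msuppD_le _ _) (fsubset_refl _)).
rewrite -big_split /=; apply/eq_bigr => g _.
rewrite -big_split /=; apply/eq_bigr => h _.
by rewrite mcoeffD mulrDl monalgUD.
Qed.

Lemma galg_mulDr : right_distributive galg_mul +%R.
Proof.
move=> f f1 f2; rewrite [in RHS](galg_mulw (fsubset_refl _) (fsubsetUl _ (msupp f2))).
rewrite [in RHS](galg_mulw (fsubset_refl _) (fsubsetUr (msupp f1) _)).
rewrite (galg_mulw (fsubset_refl _) (msuppD_le _ _)).
rewrite -big_split /=; apply/eq_bigr => g _.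
rewrite -big_split /=; apply/eq_bigr => h _.
by rewrite mcoeffD mulrDr monalgUD.
Qed.

Lemma galg_mul0l : left_zero 0 galg_mul.
Proof. by move=> f; rewrite /galg_mul msupp0 big_seq_fset0. Qed.

Lemma galg_mul0r : right_zero 0 galg_mul.
Proof.
move=> f; rewrite /galg_mul big1 // => g _.
by rewrite msupp0 big_seq_fset0.
Qed.

Lemma galg_mul_suml (I : Type) (r : seq I) (F : I -> group_algebra K G) f :
  galg_mul (\sum_(i <- r) F i) f = \sum_(i <- r) galg_mul (F i) f.
Proof.
exact: (big_morph (galg_mul^~ f) (fun _ _ => galg_mulDl _ _ _) (galg_mul0l _)).
Qed.

Lemma galg_mul_sumr (I : Type) (r : seq I) (F : I -> group_algebra K G) f :
  galg_mul f (\sum_(i <- r) F i) = \sum_(i <- r) galg_mul f (F i).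
Proof.
exact: (big_morph (galg_mul f) (fun _ _ => galg_mulDr _ _ _) (galg_mul0r _)).
Qed.

Lemma galgE f : f = \sum_(g <- msupp f) (<< f@_g *g g >> : group_algebra K G).
Proof. exact: monalgE. Qed.

Lemma galg_mul1l : left_id (of_group 1%g) galg_mul.
Proof.
move=> f; rewrite [f]galgE galg_mul_sumr; apply: eq_bigr => g _.
by rewrite galg_mulUU mul1r mul1g.
Qed.

Lemma galg_mul1r : right_id (of_group 1%g) galg_mul.
Proof.
move=> f; rewrite [f]galgE galg_mul_suml; apply: eq_bigr => g _.
by rewrite galg_mulUU mulr1 mulg1.
Qed.

Lemma galg_mulA : associative galg_mul.
Proof.
move=> f1 f2 f3; rewrite [f1]galgE !galg_mul_suml; apply: eq_bigr => g _.
rewrite [f2]galgE galg_mul_suml !galg_mul_sumr galg_mul_suml.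
apply: eq_bigr => h _.
rewrite [f3]galgE !galg_mul_sumr; apply: eq_bigr => k _.
by rewrite !galg_mulUU mulrA mulgA.
Qed.

Lemma galg_oner_neq0 : of_group 1%g != 0.
Proof. by apply/eqP/malgP => /(_ 1%g) /eqP; rewrite !mcoeffsE oner_eq0. Qed.

HB.instance Definition _ := GRing.Zmodule_isNzRing.Build (group_algebra K G)
  galg_mulA galg_mul1l galg_mul1r galg_mulDl galg_mulDr galg_oner_neq0.

Lemma galg_scaleE c f : c *: f = (<< c *g 1%g >> : group_algebra K G) * f.
Proof.
rewrite [f in RHS]galgE [RHS]galg_mul_sumr; apply/malgP => k.
rewrite mcoeffZ [in LHS](galgE f) !raddf_sum mulr_sumr /=.
apply: eq_bigr => g _.
by rewrite galg_mulUU mul1g !mcoeffU mulrnAr.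
Qed.

Lemma galg_scaleAl c f1 f2 : c *: (f1 * f2) = (c *: f1) * f2.
Proof. by rewrite !galg_scaleE mulrA. Qed.

HB.instance Definition _ := GRing.Lmodule_isLalgebra.Build K (group_algebra K G)
  galg_scaleAl.

Lemma of_groupM g h : of_group (g * h)%g = of_group g * of_group h.
Proof. by rewrite [RHS]galg_mulUU mulr1. Qed.

End GroupAlgebra.

Section GroupAlgebraCom.
Context (K : comNzRingType) (G : groupType).

Lemma galg_scaleAr (c : K) (f1 f2 : group_algebra K G) :
  c *: (f1 * f2) = f1 * (c *: f2).
Proof.
suff cE f : f * (<< c *g 1%g >> : group_algebra K G) = c *: f.
  by rewrite -cE -mulrA cE.
rewrite galg_scaleE [f]galgE [LHS]galg_mul_suml [RHS]galg_mul_sumr.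
by apply: eq_bigr => g _; rewrite !galg_mulUU mul1g mulg1 mulrC.
Qed.

HB.instance Definition _ :=
  GRing.Lalgebra_isAlgebra.Build K (group_algebra K G) galg_scaleAr.

End GroupAlgebraCom.

(* D is the group < a, b | a^2 = b^2 = 1 >: the universal property of the
   presentation. A multiplicative map between groups preserves 1, so these are
   exactly the group morphisms. *)
Definition infinite_dihedral (D : groupType) (a b : D) : Prop :=
  [/\ (a ^+ 2 = 1)%g, (b ^+ 2 = 1)%g &
      forall (H : groupType) (x y : H), (x ^+ 2 = 1)%g -> (y ^+ 2 = 1)%g ->
        exists f : {multiplicative D -> H},
          [/\ f a = x, f b = y &
              forall f' : {multiplicative D -> H},
                f' a = x -> f' b = y -> f' =1 f]].

(* A model: the semidirect product of Z by the sign action of Z/2, so that the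
   hypothesis infinite_dihedral is satisfiable. *)
Definition dihedral_model : Type := (int * bool)%type.

HB.instance Definition _ := Choice.copy dihedral_model (int * bool)%type.

Section DihedralModel.
Implicit Types u v w : dihedral_model.

Definition dm_one : dihedral_model := (0, false).
Definition dm_mul u v : dihedral_model :=
  (u.1 + (if u.2 then - v.1 else v.1), u.2 (+) v.2).
Definition dm_inv u : dihedral_model := (if u.2 then u.1 else - u.1, u.2).

Lemma dm_mulA : associative dm_mul.
Proof.
by move=> [m []] [n []] [p s] /=; rewrite /dm_mul /= ?negbK ?opprD ?opprK addrA.
Qed.

Lemma dm_mul1l : left_id dm_one dm_mul.
Proof. by move=> [m s]; rewrite /dm_mul /= add0r. Qed.

Lemma dm_mul1r : right_id dm_one dm_mul.
Proof. by move=> [m []]; rewrite /dm_mul /= ?oppr0 addr0. Qed.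

Lemma dm_mulVl : left_inverse dm_one dm_inv dm_mul.
Proof. by move=> [m []]; rewrite /dm_mul /= ?subrr ?addNr. Qed.

Lemma dm_mulVr : right_inverse dm_one dm_inv dm_mul.
Proof. by move=> [m []]; rewrite /dm_mul /= ?subrr ?addNr. Qed.

HB.instance Definition _ := isGroup.Build dihedral_model
  dm_mulA dm_mul1l dm_mul1r dm_mulVl dm_mulVr.

End DihedralModel.

Lemma intSr (n : nat) : n.+1%:Z = n%:Z + 1.
Proof. by rewrite intS addrC. Qed.

Section IntPower.
Context (H : groupType).
Implicit Types (t x : H) (m n : int).
Local Open Scope group_scope.

Let zpow t m : H :=
  match m with Posz n => t ^+ n | Negz n => t ^- n.+1 end.

Lemma zpowS t m : zpow t (m + 1)%R = t * zpow t m.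
Proof.
case: m => [n|[|n]].
- by rewrite -intSr [LHS]expgS.
- exact: (esym (mulgV t)).
- have -> : (Negz n.+1 + 1 = Negz n)%R by rewrite !NegzE [n.+2%:Z]intS opprD addrC addNKr.
  by rewrite [in RHS]/= [t ^+ n.+2]expgSr invgM mulVKg.
Qed.

Lemma zpowP t m : zpow t (m - 1)%R = t^-1 * zpow t m.
Proof. by rewrite -[in RHS](subrK 1%R m) zpowS mulKg. Qed.

Lemma zpowD t m n : zpow t (m + n)%R = zpow t m * zpow t n.
Proof.
elim/int_rect: m => [|m IH|m IH]; first by rewrite add0r mul1g.
- by rewrite intSr addrAC !zpowS IH mulgA.
- by rewrite intSr opprD addrAC !zpowP IH mulgA.
Qed.

Lemma zpowJ t x m : x * t = t^-1 * x -> x * zpow t m = zpow t (- m)%R * x.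
Proof.
move=> xt; have xtV : x * t^-1 = t * x.
  by apply: (mulgI t^-1); rewrite mulgA -xt mulgK mulKg.
elim/int_rect: m => [|m IH|m IH]; first by rewrite oppr0 mulg1 mul1g.
- by rewrite intSr opprD zpowS zpowP mulgA xt -mulgA IH mulgA.
- rewrite intSr opprD zpowP opprD !opprK in IH *.
  by rewrite zpowS mulgA xtV -mulgA IH mulgA.
Qed.

Lemma dihedral_model_lift (x y : H) : x ^+ 2 = 1 -> y ^+ 2 = 1 ->
  exists f : {multiplicative dihedral_model -> H},
    [/\ f (0%R, true) = x, f (1%R, true) = y &
        forall f' : {multiplicative dihedral_model -> H},
          f' (0%R, true) = x -> f' (1%R, true) = y -> f' =1 f].
Proof.
rewrite !expg2 => xx yy; set t := y * x.
have xt : x * t = t^-1 * x.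
  apply: (mulgI t); rewrite mulVKg /t.
  by rewrite -!mulgA [x * (x * _)]mulgA xx mul1g mulgA yy mul1g.
pose f (u : dihedral_model) := zpow t u.1 * (if u.2 then x else 1).
have fM : {morph f : u v / u * v}.
  move=> [m []] [n s]; rewrite /f /= zpowD -!mulgA; congr (_ * _).
    rewrite mulgA (zpowJ _ xt) -mulgA; congr (_ * _).
    by case: s; rewrite ?xx ?mulg1.
  by rewrite mul1g.
pose fm := HB.pack_for {multiplicative dihedral_model -> H} f
  (monoid.isMultiplicative.Build _ _ f fM).
have f0 : f (0%R, true) = x by rewrite /f /= mul1g.
have f1 : f (1%R, true) = y by rewrite /f /= expg1 /t -mulgA xx mulg1.
exists fm; split => // f' f'0 f'1.
have f't : f' (1%R, false) = t.
  by rewrite -[(1%R, false)]/(((1%R, true) : dihedral_model) * (0%R, true)) gmulfM f'1 f'0.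
have f'one : f' (0%R, false) = 1 by apply: (mulgI (f' 1)); rewrite -gmulfM !mulg1.
have f'tV : f' ((-1)%R, false) = t^-1.
  by apply: (mulgI t); rewrite mulgV -f't -gmulfM -f'one.
have f'm m : f' (m, false) = zpow t m.
  elim/int_rect: m => [|m IH|m IH]; first exact: f'one.
  - rewrite intSr zpowS -IH -f't -gmulfM; congr (f' (_, _)).
    by rewrite /= addrC.
  - rewrite intSr opprD zpowP -IH -f'tV -gmulfM; congr (f' (_, _)).
    by rewrite /= addrC.
case=> m [] /=; rewrite /f /= -f'm ?mulg1 //.
rewrite -f'0 -gmulfM; congr (f' (_, _)).
by rewrite /= addr0.
Qed.

End IntPower.

Lemma infinite_dihedral_model :
  infinite_dihedral ((0, true) : dihedral_model) ((1, true) : dihedral_model).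
Proof.
by split=> //; exact: dihedral_model_lift.
Qed.

Definition involution (R : nzRingType) (u : R) : Prop := u ^+ 2 = 1.

(* The unit nu is given together with its inverse, since group_algebra has no
   unitRingType structure. *)
Definition conjugate (R : nzRingType) (r r' : R) : Prop :=
  exists nu nuV : R, [/\ nu * nuV = 1, nuV * nu = 1 & r' = nuV * r * nu].

Definition dihedral_involutions (K : nzRingType) (D : groupType) (a b : D) :
    6.-tuple (group_algebra K D) :=
  [tuple 1; -1; of_group K a; - of_group K a; of_group K b; - of_group K b].

(* Main.v *)
Require Import Defs.
From HB Require Import structures.
From mathcomp Require Import all_boot all_order all_algebra.
From mathcomp Require Import finmap monalg ring.

Set Implicit Arguments.
Unset Strict Implicit.
Unset Printing Implicit Defensive.

Import GRing.Theory.

Local Open Scope ring_scope.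

(* The element X = ((a + b) / 2)^2 = (2 + ab + ba) / 4 is central and
   1, a, b, ab is a basis of K D over K[X]. Sending a to diag(1, -1) and b to
   [[2X - 1, 2(1 - X)], [2X, 1 - 2X]] identifies K D with the order S of those
   matrices over K[X] whose (0, 1) entry vanishes at X = 1 and whose (1, 0)
   entry vanishes at X = 0. If U in S is an involution other than 1 and -1, then
   (1 + U) / 2 is an idempotent of trace 1 and determinant 0, hence, K[X] being
   principal, a product (x, y)^T (u, v) with x u + y v = 1. So x v vanishes at 1
   and y u vanishes at 0; which of the factors vanish there tells to which of
   a, -a, b, -b the involution is conjugate, the conjugating matrix of
   determinant 1 being built from eigenvectors. The six classes are separated by
   the characters K D -> K with a, b |-> 1, 1, then 1, -1, then -1, 1. *)

(** * The unit group of a ring, as a target for the universal property of [D] *)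

Definition units_of (R : unitRingType) : Type := {x : R | x \is a GRing.unit}.

HB.instance Definition _ (R : unitRingType) :=
  Choice.copy (units_of R) {x : R | x \is a GRing.unit}.

Section UnitGroup.
Context (R : unitRingType).
Implicit Types x y z : units_of R.

Local Notation unit_pair := (exist (fun z : R => z \is a GRing.unit)).

Definition units_one : units_of R := unit_pair 1 (unitr1 R).

Lemma units_mul_subproof x y : sval x * sval y \is a GRing.unit.
Proof. by case: x y => [x Ux] [y Uy]; rewrite /= unitrMl. Qed.

Definition units_mul x y : units_of R := unit_pair _ (units_mul_subproof x y).

Lemma units_inv_subproof x : (sval x)^-1 \is a GRing.unit.
Proof. by case: x => [x Ux]; rewrite /= unitrV. Qed.

Definition units_inv x : units_of R := unit_pair _ (units_inv_subproof x).

Lemma units_mulA : associative units_mul.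
Proof. by move=> x y z; apply: val_inj; exact: mulrA. Qed.

Lemma units_mul1l : left_id units_one units_mul.
Proof. by move=> x; apply: val_inj; exact: mul1r. Qed.

Lemma units_mul1r : right_id units_one units_mul.
Proof. by move=> x; apply: val_inj; exact: mulr1. Qed.

Lemma units_mulVl : left_inverse units_one units_inv units_mul.
Proof. by case=> x Ux; apply: val_inj; exact: mulVr. Qed.

Lemma units_mulVr : right_inverse units_one units_inv units_mul.
Proof. by case=> x Ux; apply: val_inj; exact: divrr. Qed.

HB.instance Definition _ := isGroup.Build (units_of R)
  units_mulA units_mul1l units_mul1r units_mulVl units_mulVr.

End UnitGroup.

(** * Ring morphisms out of the group algebra, and induction on the group *)

Lemma galg_lift (K S : nzRingType) (G : groupType) (iota : {rmorphism K -> S})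
    (rho : G -> S) :
    rho 1%g = 1 -> {morph rho : g h / (g * h)%g >-> g * h} ->
    (forall c g, GRing.comm (iota c) (rho g)) ->
  exists Phi : {rmorphism group_algebra K G -> S},
    (forall g, Phi (of_group K g) = rho g) /\
    (forall c f, Phi (c *: f) = iota c * Phi f).
Proof.
move=> rho1 rhoM crho.
pose phi : group_algebra K G -> S := mmap iota rho.
have phiU c g : phi << c *g g >> = iota c * rho g by rewrite /phi mmapU.
have phi1 g : phi (of_group K g) = rho g by rewrite phiU rmorph1 mul1r.
have phiD : {morph phi : x y / x + y} by move=> x y; exact: mmapD.
have phiB : {morph phi : x y / x - y} by move=> x y; exact: mmapB.
have phi0 : phi 0 = 0 by exact: mmap0.
have phi_sum I (r : seq I) (F : I -> group_algebra K G) :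
    phi (\sum_(i <- r) F i) = \sum_(i <- r) phi (F i).
  exact: (big_morph phi phiD phi0).
have phiM : {morph phi : x y / x * y}.
  move=> f g; rewrite [f]galgE [g]galgE mulr_suml !phi_sum mulr_suml.
  apply: eq_bigr => i _; rewrite mulr_sumr !phi_sum mulr_sumr.
  apply: eq_bigr => j _; rewrite [_ * _]galg_mulUU !phiU rmorphM rhoM.
  (* On monomials, the coefficient of the second factor has to move left past [rho i], which is
     [crho]. *)
  by rewrite -!mulrA [in RHS](mulrA (rho i)) -crho !mulrA.
pose Phi := HB.pack_for {rmorphism group_algebra K G -> S} phi
  (GRing.isZmodMorphism.Build _ _ phi phiB)
  (GRing.isMonoidMorphism.Build _ _ phi (conj (etrans (phi1 _) rho1) phiM)).
exists Phi; split=> // c f.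
by rewrite galg_scaleE [LHS]phiM phiU rho1 mulr1.
Qed.

Lemma of_group_involution (K : nzRingType) (G : groupType) (g : G) :
  (g ^+ 2 = 1)%g -> of_group K g * of_group K g = 1.
Proof. by move=> gg; rewrite -of_groupM -expg2 gg. Qed.

(** An involution is its own inverse, so [x] and [y] lie in the unit group of [S]; the presentation
    gives a group morphism into it, which extends linearly. *)
Lemma dihedral_galg_lift (K : nzRingType) (S : unitRingType) (D : groupType)
    (a b : D) (iota : {rmorphism K -> S}) (x y : S) :
    infinite_dihedral a b -> (forall c z, GRing.comm (iota c) z) ->
    x * x = 1 -> y * y = 1 ->
  exists Phi : {rmorphism group_algebra K D -> S},
    [/\ Phi (of_group K a) = x, Phi (of_group K b) = y &
        forall c f, Phi (c *: f) = iota c * Phi f].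
Proof.
move=> [_ _ univD] comm_iota xx yy.
have unitP (z : S) : z * z = 1 -> z \is a GRing.unit.
  by move=> zz; apply/unitrP; exists z.
pose ux : units_of S := exist _ x (unitP x xx).
pose uy : units_of S := exist _ y (unitP y yy).
have [||f [fa fb _]] := univD (units_of S) ux uy.
- by rewrite expg2; apply: val_inj.
- by rewrite expg2; apply: val_inj.
have f1 : f 1%g = 1%g by apply: (mulgI (f 1%g)); rewrite -gmulfM !mulg1.
have [|||Phi [Phi_g PhiZ]] := @galg_lift K S D iota (fun g => sval (f g)).
- by rewrite f1.
- by move=> g h; rewrite gmulfM.
- by move=> c g; apply: comm_iota.
by exists Phi; rewrite !Phi_g fa fb.
Qed.

(** That [a] and [b] generate [D] has to be extracted from the universal property: the composite
    [D -> dihedral_model -> D] fixes [a] and [b], hence is the identity, so every element of [D]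
    comes from the explicit model. *)
Lemma dihedral_ind (D : groupType) (a b : D) (P : D -> Prop) :
    infinite_dihedral a b -> P 1%g ->
    (forall g, P g -> P (a * g)%g) -> (forall g, P g -> P (b * g)%g) ->
  forall g, P g.
Proof.
move=> [aa bb univD] P1 Pa Pb.
have [f [fa fb _]] :=
  univD dihedral_model (0, true) (1, true) (erefl _) (erefl _).
have [h [ha hb _]] := dihedral_model_lift aa bb.
have [k [_ _ k_uniq]] := univD D a b aa bb.
have hf : h \o f =1 k.
  apply: (k_uniq (h \o f : {multiplicative D -> D})) => /=.
    by rewrite fa ha.
  by rewrite fb hb.
have idk : idfun =1 k.
  exact: (k_uniq (idfun : {multiplicative D -> D}) erefl erefl).
suff Ph u : P (h u) by move=> g; rewrite -[g]/(idfun g) idk -hf; apply: Ph.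
have h1 : h 1%g = 1%g by apply: (mulgI (h 1%g)); rewrite -gmulfM !mulg1.
(* In the model [b * a] is the translation by 1 and [a * b] the translation by -1, so each step of
   the induction on the integer prepends two generators. *)
have h_rot m : h (m + 1, false) = (b * (a * h (m, false)))%g.
  rewrite -ha -hb -!gmulfM; congr (h (_, _)).
  by rewrite /= add0r opprK addrC.
have h_rotV m : h (m - 1, false) = (a * (b * h (m, false)))%g.
  rewrite -ha -hb -!gmulfM; congr (h (_, _)).
  by rewrite /= add0r opprD opprK addrC.
have h_refl m : h (m, true) = (a * h (- m, false))%g.
  rewrite -ha -gmulfM; congr (h (_, _)).
  by rewrite /= add0r opprK.
have Prot m : P (h (m, false)).
  elim/int_rect: m => [|m IH|m IH]; first by change (P (h 1%g)); rewrite h1.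
  - by rewrite intSr h_rot; apply/Pb/Pa.
  - by rewrite intSr opprD h_rotV; apply/Pa/Pb.
by case: u => m [|] //; rewrite h_refl; apply: Pa.
Qed.

(** * Two by two matrices in coordinates *)

Definition mx22 (R : Type) (m00 m01 m10 m11 : R) : 'M[R]_2 :=
  \matrix_(i, j) if i == 0 then (if j == 0 then m00 else m01)
                 else (if j == 0 then m10 else m11).

Lemma mx22_eta (R : Type) (M : 'M[R]_2) :
  M = mx22 (M 0 0) (M 0 1) (M 1 0) (M 1 1).
Proof.
apply/matrixP => -[[|[|//]] ?] [[|[|//]] ?]; rewrite mxE /=;
  by congr (M _ _); apply: val_inj.
Qed.

Section Mx22.
Context (R : comNzRingType).

Lemma mx22D (a b c d a' b' c' d' : R) :
  mx22 a b c d + mx22 a' b' c' d' = mx22 (a + a') (b + b') (c + c') (d + d').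
Proof. by apply/matrixP => i j; rewrite !mxE; case: ifP; case: ifP. Qed.

Lemma mx22N (a b c d : R) : - mx22 a b c d = mx22 (- a) (- b) (- c) (- d).
Proof. by apply/matrixP => i j; rewrite !mxE; case: ifP; case: ifP. Qed.

Lemma mx22M (a b c d a' b' c' d' : R) :
  mx22 a b c d * mx22 a' b' c' d' =
  mx22 (a * a' + b * c') (a * b' + b * d') (c * a' + d * c') (c * b' + d * d').
Proof.
apply/matrixP => i j; rewrite !mxE !big_ord_recl big_ord0 !mxE /= addr0.
by case: ifP; case: ifP.
Qed.

Lemma mx22_scalar (x : R) : x%:M = mx22 x 0 0 x.
Proof. by apply/matrixP => -[[|[|//]] ?] [[|[|//]] ?]; rewrite !mxE. Qed.

Lemma mx22_1 : 1 = mx22 1 0 0 1 :> 'M[R]_2.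
Proof. exact: (mx22_scalar 1). Qed.

Lemma mx22_0 : 0 = mx22 0 0 0 0 :> 'M[R]_2.
Proof. by apply/matrixP => i j; rewrite !mxE; case: ifP; case: ifP. Qed.

Lemma mx22_inj (a b c d a' b' c' d' : R) :
  mx22 a b c d = mx22 a' b' c' d' -> [/\ a = a', b = b', c = c' & d = d'].
Proof.
move/matrixP=> E; have := (E 0 0, E 0 1, E 1 0, E 1 1).
by rewrite !mxE /= => -[[[-> ->] ->] ->].
Qed.

End Mx22.

(** * Normal forms over [K[X]] and the matrix representation *)

Lemma horner_alg_comm (K : comNzRingType) (A : algType K) (x y : A)
    (p : {poly K}) :
  GRing.comm x y -> GRing.comm (horner_alg x p) y.
Proof.
move=> xy; elim/poly_ind: p => [|p c IH].
  by rewrite rmorph0; apply/commr_sym/commr0.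
rewrite rmorphD rmorphM /= horner_algX horner_algC.
apply/commr_sym/commrD; first by apply: commrM; apply: commr_sym.
by rewrite /GRing.comm -scalerAl -scalerAr mul1r mulr1.
Qed.

Definition refl_a (K : nzRingType) : 'M[{poly K}]_2 := mx22 1 0 0 (- 1).

Definition refl_b (K : nzRingType) : 'M[{poly K}]_2 :=
  mx22 (2 * 'X - 1) (2 * (1 - 'X)) (2 * 'X) (1 - 2 * 'X).

Definition in_order (K : nzRingType) (M : 'M[{poly K}]_2) : Prop :=
  (M 0 1).[1] = 0 /\ (M 1 0).[0] = 0.

Section NormalForm.
Context (K : fieldType) (K2 : 2 != 0 :> K) (R : algType K) (A B : R).
Context (AA : A * A = 1) (BB : B * B = 1).

Let x0 : R := 4^-1 *: (2 + (A * B + B * A)).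

Let K4 : 4 != 0 :> K.
Proof. by rewrite (natrM _ 2 2) mulf_neq0. Qed.

Local Notation hx := (horner_alg x0).

Let hxZ : hx (4 * 'X - 2) = A * B + B * A.
Proof.
rewrite rmorphB rmorphM !rmorph_nat /= horner_algX /x0.
by rewrite mulr_natl -scaler_nat scalerA divff // scale1r addrC addKr.
Qed.

(** [A] commutes with [A * B + B * A], both products being [B + A * B * A]; hence it commutes with
    every polynomial in [x0]. *)
Let comA p : A * hx p = hx p * A.
Proof.
apply/esym/horner_alg_comm; rewrite /GRing.comm /x0 -scalerAl -scalerAr.
congr (_ *: _); rewrite mulrDl mulrDr mulr_natl mulr_natr; congr (_ + _).
by rewrite mulrDl mulrDr !mulrA AA mul1r -[B * A * A]mulrA AA mulr1 addrC.
Qed.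

Let comB p : B * hx p = hx p * B.
Proof.
apply/esym/horner_alg_comm; rewrite /GRing.comm /x0 -scalerAl -scalerAr.
congr (_ *: _); rewrite mulrDl mulrDr mulr_natl mulr_natr; congr (_ + _).
by rewrite mulrDl mulrDr !mulrA BB mul1r -[A * B * B]mulrA BB mulr1 addrC.
Qed.

Definition normal_form (p q r s : {poly K}) : R :=
  hx p + hx q * A + hx r * B + hx s * (A * B).

Lemma normal_form_mula p q r s : A * normal_form p q r s = normal_form q p s r.
Proof.
rewrite /normal_form !mulrDr !mulrA !comA -!mulrA AA mulr1.
rewrite [A * (A * B)]mulrA AA mul1r.
by rewrite -!addrA addrCA; congr (_ + (_ + _)); rewrite addrC.
Qed.

Lemma normal_form_mulb p q r s :
  B * normal_form p q r s =
  normal_form (r + q * (4 * 'X - 2)) (- s) (p + s * (4 * 'X - 2)) (- q).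
Proof.
set z := 4 * 'X - 2.
(* The anticommutator is central and equals [hx z], so this rule moves [A] to the left of [B]. *)
have BA : B * A = hx z - A * B by rewrite hxZ addrC addKr.
move: z BA => z BA.
rewrite /normal_form !mulrDr !mulrA !comB -!mulrA BB mulr1.
rewrite [B * (A * B)]mulrA BA mulrBl -[A * B * B]mulrA BB mulr1.
rewrite !rmorphD !rmorphN !rmorphM /= !mulrDl !mulNr !mulrBr !mulrA !addrA.
by rewrite [LHS](ACl (4*2*6*1*5*3))%AC.
Qed.

Definition is_normal_form (f : R) : Prop :=
  exists p q r s, f = normal_form p q r s.

Lemma is_normal_form0 : is_normal_form 0.
Proof. by exists 0, 0, 0, 0; rewrite /normal_form !rmorph0 !mul0r !addr0. Qed.

Lemma is_normal_form1 : is_normal_form 1.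
Proof.
by exists 1, 0, 0, 0; rewrite /normal_form rmorph1 !rmorph0 !mul0r !addr0.
Qed.

Lemma is_normal_form_mula f : is_normal_form f -> is_normal_form (A * f).
Proof.
by case=> p [q [r [s ->]]]; exists q, p, s, r; rewrite normal_form_mula.
Qed.

Lemma is_normal_form_mulb f : is_normal_form f -> is_normal_form (B * f).
Proof. by case=> p [q [r [s ->]]]; rewrite normal_form_mulb; do 4! eexists. Qed.

Lemma is_normal_formD f g :
  is_normal_form f -> is_normal_form g -> is_normal_form (f + g).
Proof.
case=> [p [q [r [s ->]]]] [p' [q' [r' [s' ->]]]].
exists (p + p'), (q + q'), (r + r'), (s + s').
rewrite /normal_form !rmorphD /= !mulrDl !addrA.
by rewrite [LHS](ACl (1*5*2*6*3*7*4*8))%AC.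
Qed.

Lemma is_normal_formZ c f : is_normal_form f -> is_normal_form (c *: f).
Proof.
case=> [p [q [r [s ->]]]]; exists (c *: p), (c *: q), (c *: r), (c *: s).
by rewrite /normal_form !linearZ /= !mulr_algl !scalerDr !scalerAl.
Qed.

Context (Phi : {rmorphism R -> 'M[{poly K}]_2}).
Context (PhiA : Phi A = refl_a K) (PhiB : Phi B = refl_b K).
Context (PhiZ : forall c f, Phi (c *: f) = c%:P%:M * Phi f).

Let Phix0 : Phi x0 = 'X%:M.
Proof.
rewrite /x0 PhiZ rmorphD rmorph_nat rmorphD !rmorphM PhiA PhiB /=.
have -> : 2 = 2%:M :> 'M[{poly K}]_2 by rewrite -(rmorph_nat (@scalar_mx _ 2)).
rewrite /refl_a /refl_b !mx22_scalar !mx22M !mx22D !mx22M.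
have h4 : 4^-1%:P * 4 = 1 :> {poly K} by rewrite -polyC_natr -polyCM mulVf.
have h4X : 4^-1%:P * (4 * 'X) = 'X :> {poly K} by rewrite mulrA h4 mul1r.
by congr mx22; [rewrite -[RHS]h4X | | | rewrite -[RHS]h4X]; ring.
Qed.

Let Phihx p : Phi (hx p) = p%:M.
Proof.
elim/poly_ind: p => [|p c IH]; first by rewrite !rmorph0.
rewrite rmorphD rmorphM /= horner_algX horner_algC rmorphD rmorphM IH Phix0.
by rewrite PhiZ rmorph1 mulr1 raddfD [RHS]/= scalar_mxM.
Qed.

Lemma rep_normal_form p q r s : Phi (normal_form p q r s) =
  mx22 (p + q + (r + s) * (2 * 'X - 1)) (2 * (1 - 'X) * (r + s))
       (2 * 'X * (r - s)) (p - q - (r - s) * (2 * 'X - 1)).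
Proof.
rewrite /normal_form !rmorphD !rmorphM !Phihx PhiA PhiB !mx22_scalar.
by rewrite /refl_a /refl_b !mx22M !mx22D; congr mx22; ring.
Qed.

Let P2 : 2 != 0 :> {poly K}.
Proof. by rewrite -polyC_natr polyC_eq0. Qed.

Let dbl0 (x : {poly K}) : x + x = 0 -> x = 0.
Proof.
by move/eqP; rewrite -mulr2n -(mulr_natl x) mulf_eq0 (negPf P2) => /eqP.
Qed.

(** The off-diagonal entries force [r + s = 0] and [r - s = 0]; the diagonal ones then leave
    [p + q = 0] and [p - q = 0]. Each pair vanishes since 2 is nonzero. *)
Lemma rep_eq0 f : is_normal_form f -> Phi f = 0 -> f = 0.
Proof.
case=> p [q [r [s ->]]].
have X1 : 1 - 'X != 0 :> {poly K}.
  by rewrite -opprB oppr_eq0 polyXsubC_eq0.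
rewrite rep_normal_form mx22_0 => /mx22_inj [].
move=> E00 /eqP; rewrite !mulf_eq0 (negPf P2) (negPf X1) /= => /eqP rs.
move=> /eqP; rewrite !mulf_eq0 (negPf P2) polyX_eq0 /= subr_eq0 => /eqP rs'.
move: rs E00; rewrite rs' subrr mul0r subr0 => /dbl0 ->.
rewrite addr0 mul0r addr0 => E00 /subr0_eq pq.
have q0 : q = 0 by apply: dbl0; rewrite -{1}pq.
by rewrite pq q0 /normal_form !rmorph0 !mul0r !addr0.
Qed.

Lemma in_order_rep M : in_order M -> exists f, Phi f = M.
Proof.
case=> /eqP M01 /eqP M10.
have [/factor_theorem [m1 E1] /factor_theorem [m2 E2]] := (M01, M10).
pose w : {poly K} := 2 * 'X - 1.
(* The coefficients solve the four entries of [rep_normal_form] for [p], [q], [r], [s], where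
   [r + s = - m1 / 2] and [r - s = m2 / 2]; the factor 4 clears the denominators. *)
exists (4^-1 *: normal_form (2 * (M 0 0 + M 1 1) + (m2 + m1) * w)
                           (2 * (M 0 0 - M 1 1) - (m2 - m1) * w)
                           (m2 - m1) (- m1 - m2)).
have M4 : M = 4^-1%:P%:M * (4%:M * M).
  rewrite mulrA -(rmorphM (@scalar_mx _ 2)) -polyC_natr -polyCM mulVf //.
  by rewrite mul1r.
rewrite [RHS]M4 PhiZ rep_normal_form [M in RHS]mx22_eta E1 E2.
rewrite [4%:M]mx22_scalar mx22M.
by congr (_ * mx22 _ _ _ _); rewrite /w ?polyC0 ?polyC1; ring.
Qed.

Lemma rep_in_order f : is_normal_form f -> in_order (Phi f).
Proof.
case=> p [q [r [s ->]]]; rewrite rep_normal_form.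
by split; rewrite !mxE /= !hornerE ?subrr ?mulr0 ?mul0r.
Qed.

End NormalForm.

(** Group elements are words in [a] and [b], and normal forms are closed under left multiplication
    by either; linear combinations give the rest. *)
Lemma galg_is_normal_form (K : fieldType) (K2 : 2 != 0 :> K) (D : groupType)
    (a b : D) (hD : infinite_dihedral a b) (f : group_algebra K D) :
  is_normal_form (of_group K a) (of_group K b) f.
Proof.
have [aa bb _] := hD.
have AA : of_group K a * of_group K a = 1 by exact: of_group_involution.
have BB : of_group K b * of_group K b = 1 by exact: of_group_involution.
have nf_g g : is_normal_form (of_group K a) (of_group K b) (of_group K g).
  move: g; apply: (dihedral_ind hD) => [|g|g]; first exact: is_normal_form1.
  - by rewrite of_groupM; apply: is_normal_form_mula.
  - by rewrite of_groupM; apply: is_normal_form_mulb.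
rewrite [f]galgE; apply: (big_ind (is_normal_form _ _)).
- exact: is_normal_form0.
- exact: is_normal_formD.
move=> g _.
have -> : << f@_g *g g >> = f@_g *: of_group K g :> group_algebra K D.
  by rewrite galg_scaleE [RHS]galg_mulUU mulr1 mul1g.
exact: is_normal_formZ.
Qed.

Lemma dihedral_galg_order (K : fieldType) (K2 : 2 != 0 :> K) (D : groupType)
    (a b : D) (hD : infinite_dihedral a b) :
  exists Phi : {rmorphism group_algebra K D -> 'M[{poly K}]_2},
    [/\ Phi (of_group K a) = refl_a K, Phi (of_group K b) = refl_b K,
        injective Phi & forall M, in_order M <-> exists f, Phi f = M].
Proof.
have [aa bb _] := hD.
have AA : of_group K a * of_group K a = 1 by exact: of_group_involution.
have BB : of_group K b * of_group K b = 1 by exact: of_group_involution.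
have refl_aa : refl_a K * refl_a K = 1.
  by rewrite mx22M mx22_1; congr mx22; ring.
have refl_bb : refl_b K * refl_b K = 1.
  by rewrite mx22M mx22_1; congr mx22; ring.
have [|Phi [PhiA PhiB PhiZ]] :=
  @dihedral_galg_lift K _ D a b (@scalar_mx _ 2 \o polyC) _ _ hD _
    refl_aa refl_bb.
  by move=> c z; exact: (esym (scalar_mxC c%:P z)).
exists Phi; split=> //.
- apply: raddf_inj => f.
  exact: (rep_eq0 K2 PhiA PhiB PhiZ (galg_is_normal_form K2 hD f)).
- move=> M; split; first exact: (in_order_rep K2 PhiA PhiB PhiZ).
  case=> f <-.
  exact: (rep_in_order K2 PhiA PhiB PhiZ (galg_is_normal_form K2 hD f)).
Qed.

(** * Rank one idempotents and involutions of the order *)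

(** With [x] the gcd of the first row, [(e, f) = x (u, v)] with [u], [v] coprime. The determinant
    being 0, the second row is a multiple [y (u, v)], and a Bezout relation recovers [y]. *)
Lemma rank1_idempotent_factor (K : fieldType) (e f g k : {poly K}) :
    e + k = 1 -> e * k = f * g ->
  exists x y u v,
    [/\ x * u + y * v = 1, e = x * u, f = x * v, g = y * u & k = y * v].
Proof.
move=> ek1 ekfg; have [ef0|] := eqVneq (gcdp e f) 0.
  move/eqP: ef0; rewrite gcdp_eq0 => /andP[/eqP e0 /eqP f0].
  (* A zero first row forces [k = 1]. *)
  exists 0, 1, g, 1; rewrite e0 f0 add0r in ek1 *.
  by split; rewrite ?ek1 ?mul0r ?mul1r ?add0r.
set x := gcdp e f => x0.
have ux : e %/ x * x = e by apply/divpK/dvdp_gcdl.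
have vx : f %/ x * x = f by apply/divpK/dvdp_gcdr.
move: (e %/ x) (f %/ x) ux vx => u v ux vx.
have [[s t] /= st] : exists w, w.1 * u + w.2 * v = 1.
  have [[s t] /= /eqpP[[c d] /andP[/= c0 d0] st]] := Bezoutp e f.
  (* [Bezoutp] yields the gcd only up to a nonzero constant; [c / d] corrects this. *)
  exists ((c / d) *: s, (c / d) *: t) => /=; apply: (mulIf x0).
  rewrite mul1r mulrDl -!mulrA ux vx -!scalerAl -scalerDr mulrC -scalerA st.
  by rewrite scalerA mulVf // scale1r.
have ukvg : u * k = v * g.
  by apply: (mulIf x0); rewrite mulrAC ux ekfg -vx; ring.
have yu : (s * g + t * k) * u = g.
  by rewrite -[RHS]mul1r -st !mulrDl -[t * k * u]mulrA [k * u]mulrC ukvg; ring.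
have yv : (s * g + t * k) * v = k.
  by rewrite -[RHS]mul1r -st !mulrDl -[s * g * v]mulrA [g * v]mulrC -ukvg; ring.
exists x, (s * g + t * k), u, v.
by rewrite yu yv ![x * _]mulrC ux vx ek1.
Qed.

(** Both [N] and its inverse are kept in the order so that they lift to the group algebra. *)
Definition order_conj (K : fieldType) (M M' : 'M[{poly K}]_2) : Prop :=
  exists N NV, [/\ in_order N, in_order NV, N * NV = 1, NV * N = 1
                 & M' = NV * M * N].

(** Proves an identity modulo a known equation: [s = t] is a suitable multiple of it, and the
    remaining goal is left to [ring]. *)
Lemma eq_sub_eq (R : zmodType) (s t l r : R) :
  s = t -> l - r = s - t -> l = r.
Proof. by move=> -> /eqP; rewrite subrr subr_eq0 => /eqP. Qed.

(** This is [2 E - 1] for [E] the product of the column [(x, y)] and the row [(u, v)]. When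
    [x u + y v = 1], it has the eigenvectors [(x, y)] for 1 and [(-v, u)] for -1. *)
Definition rank1_refl (R : nzRingType) (x y u v : R) : 'M[R]_2 :=
  mx22 (2 * x * u - 1) (2 * x * v) (2 * y * u) (2 * y * v - 1).

Lemma rank1_refl_conj (K : fieldType) (x y u v : {poly K}) :
    x * u + y * v = 1 -> v.[1] = 0 -> (y * u).[0] = 0 ->
  order_conj (rank1_refl x y u v) (refl_a K) \/
  order_conj (rank1_refl x y u v) (refl_b K).
Proof.
move=> xuyv v1 /eqP; rewrite hornerM mulf_eq0 => /orP[] /eqP yu0; [left|right].
  (* The columns of [N] are the two eigenvectors and [NV] is its adjugate. Here [y] vanishes at 0,
     which together with [v.[1] = 0] puts both in the order. *)
  pose N := mx22 x (- v) y u; pose NV := mx22 u v (- y) x.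
  have NVN : NV * N = 1.
    rewrite mx22M mx22_1; congr mx22;
    [rewrite -[RHS]xuyv | | | rewrite -[RHS]xuyv]; ring.
  exists N, NV; split=> //.
  - by split; rewrite mxE /= ?hornerE ?v1 ?oppr0.
  - by split; rewrite mxE /= ?hornerE ?yu0 ?oppr0.
  - by rewrite mx22M mx22_1; congr mx22;
    [rewrite -[RHS]xuyv | | | rewrite -[RHS]xuyv]; ring.
  (* It suffices that [N] intertwines the two reflections. *)
  - rewrite -mulrA (_ : _ * N = N * refl_a K) ?mulrA ?NVN ?mul1r //.
    rewrite !mx22M; congr mx22.
    + apply: (eq_sub_eq (congr1 (fun z => 2 * x * z) xuyv)); ring.
    + ring.
    + apply: (eq_sub_eq (congr1 (fun z => 2 * y * z) xuyv)); ring.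
    + ring.
pose X : {poly K} := 'X.
(* N sends the eigenvectors (1, 1), (X - 1, X) of b to (x, y), (-v, u). *)
pose N := mx22 (x * X + v) (x * (1 - X) - v) (y * X - u) (y * (1 - X) + u).
pose NV := mx22 (y * (1 - X) + u) (v - x * (1 - X)) (u - y * X) (x * X + v).
have NVN : NV * N = 1.
  rewrite mx22M mx22_1; congr mx22;
    [rewrite -[RHS]xuyv | | | rewrite -[RHS]xuyv]; ring.
exists N, NV; split=> //.
- by split; rewrite mxE /= !hornerE ?v1 ?yu0 ?subrr ?mulr0 ?subrr ?oppr0.
- by split; rewrite mxE /= !hornerE ?v1 ?yu0 ?subrr ?mulr0 ?subrr ?oppr0.
- by rewrite mx22M mx22_1; congr mx22;
    [rewrite -[RHS]xuyv | | | rewrite -[RHS]xuyv]; ring.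
- rewrite -mulrA (_ : _ * N = N * refl_b K) ?mulrA ?NVN ?mul1r //.
  rewrite !mx22M -/X; congr mx22.
  + apply: (eq_sub_eq (congr1 (fun z => 2 * x * X * z) xuyv)); ring.
  + apply: (eq_sub_eq (congr1 (fun z => 2 * x * (1 - X) * z) xuyv)); ring.
  + apply: (eq_sub_eq (congr1 (fun z => 2 * y * X * z) xuyv)); ring.
  + apply: (eq_sub_eq (congr1 (fun z => 2 * y * (1 - X) * z) xuyv)); ring.
Qed.

Lemma order_conjN (K : fieldType) (M M' : 'M[{poly K}]_2) :
  order_conj (- M) M' -> order_conj M (- M').
Proof.
case=> N [NV [? ? ? ? ->]]; exists N, NV.
by split; rewrite // mulrN mulNr opprK.
Qed.

Lemma order_involution (K : fieldType) (K2 : 2 != 0 :> K) (U : 'M[{poly K}]_2) :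
    in_order U -> U * U = 1 ->
  [\/ U = 1, U = - 1,
      order_conj U (refl_a K) \/ order_conj U (- refl_a K) |
      order_conj U (refl_b K) \/ order_conj U (- refl_b K)].
Proof.
case; rewrite [U]mx22_eta !mxE /=.
pose h : {poly K} := 2^-1%:P.
have h2 : h * 2 = 1 by rewrite -polyC_natr -polyCM mulVf.
(* The entries [e], [f], [g], [k] introduced below are those of [E = (1 + U) / 2], and [U * U = 1]
   becomes [E * E = E]. *)
have halve (z : {poly K}) : exists w, z = 2 * w.
  by exists (h * z); rewrite mulrA [2 * h]mulrC h2 mul1r.
have [e Ee] := halve (1 + U 0 0).
have {Ee}-> : U 0 0 = 2 * e - 1 by rewrite -Ee addrC addKr.
have [k Ek] := halve (1 + U 1 1).
have {Ek}-> : U 1 1 = 2 * k - 1 by rewrite -Ek addrC addKr.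
have [f ->] := halve (U 0 1); have [g ->] := halve (U 1 0).
move=> f1 g0; rewrite mx22M mx22_1 => /mx22_inj [E1 E2 E3 E4].
have P4 : 4 != 0 :> {poly K}.
  by rewrite -polyC_natr polyC_eq0 (natrM _ 2 2) mulf_neq0.
have {}E1 : e * (1 - e) = f * g.
  apply: (mulfI P4); apply: (eq_sub_eq (esym E1)); ring.
have {}E4 : k * (1 - k) = f * g.
  apply: (mulfI P4); apply: (eq_sub_eq (esym E4)); ring.
have {}E2 : f * (e + k - 1) = 0.
  apply: (mulfI P4); apply: (eq_sub_eq E2); ring.
have {}E3 : g * (e + k - 1) = 0.
  apply: (mulfI P4); apply: (eq_sub_eq E3); ring.
(* If the trace of [E] is not 1, then [f = g = 0] and [e], [k] are each 0 or 1; the mixed cases have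
   trace 1, so [U] is 1 or -1. *)
have [/subr0_eq ek1|ek1] := eqVneq (e + k - 1) 0; last first.
  move/eqP: E2; rewrite mulf_eq0 (negPf ek1) orbF => /eqP f_0.
  move/eqP: E3; rewrite mulf_eq0 (negPf ek1) orbF => /eqP g_0.
  move/eqP: E1; rewrite f_0 mul0r mulf_eq0 subr_eq0 => /orP[/eqP e0|/eqP e1].
    move/eqP: E4; rewrite f_0 mul0r mulf_eq0 subr_eq0 => /orP[/eqP k0|/eqP k1].
      constructor 2; rewrite e0 k0 g_0 !mulr0 sub0r.
      by rewrite mx22N oppr0.
    by case/eqP: ek1; rewrite e0 -k1 add0r subrr.
  move/eqP: E4; rewrite f_0 mul0r mulf_eq0 subr_eq0 => /orP[/eqP k0|/eqP k1].
    by case/eqP: ek1; rewrite k0 -e1 addr0 subrr.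
  constructor 1; rewrite -e1 -k1 g_0 !mulr0 mulr1.
  by rewrite -[2]/(1 + 1) addrK.
have ekfg : e * k = f * g by rewrite -E1 -ek1 addrC addKr.
have [x [y [u [v [xuyv De Df Dg Dk]]]]] := rank1_idempotent_factor ek1 ekfg.
have P2 : (2 : {poly K}).[1] != 0 by rewrite -polyC_natr hornerC.
have P2' : (2 : {poly K}).[0] != 0 by rewrite -polyC_natr hornerC.
move/eqP: f1; rewrite hornerM mulf_eq0 (negPf P2) Df hornerM mulf_eq0 /=.
move/eqP: g0; rewrite hornerM mulf_eq0 (negPf P2') Dg /= => /eqP yu0.
have -> : mx22 (2 * e - 1) (2 * (x * v)) (2 * (y * u)) (2 * k - 1) =
    rank1_refl x y u v by rewrite De Dk /rank1_refl !mulrA.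
case/orP=> /eqP xv1; last first.
  case: (rank1_refl_conj xuyv xv1 yu0) => ?.
    by constructor 3; left.
  by constructor 4; left.
(* -U swaps the two eigenvectors, which moves the vanishing at 1 from x to v. *)
have negE : - rank1_refl x y u v = rank1_refl (- v) u (- y) x.
  rewrite mx22N; congr mx22; last 1 first.
  + apply: (eq_sub_eq (congr1 (fun z => - 2 * z) xuyv)); ring.
  + apply: (eq_sub_eq (congr1 (fun z => - 2 * z) xuyv)); ring.
  + ring.
  + ring.
have xuyv' : - v * - y + u * x = 1 by rewrite -xuyv; ring.
have yu0' : (u * - y).[0] = 0 by rewrite mulrN hornerN mulrC yu0 oppr0.
case: (rank1_refl_conj xuyv' xv1 yu0'); rewrite -negE => /order_conjN ?.
- by constructor 3; right.
- by constructor 4; right.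
Qed.

(** * Conjugacy in the group algebra and separation of the six classes *)

Lemma conjugate_refl (R : nzRingType) (r : R) : conjugate r r.
Proof. by exists 1, 1; rewrite !mulr1 mul1r. Qed.

Lemma conjugate_sym (R : nzRingType) (r s : R) : conjugate r s -> conjugate s r.
Proof.
case=> n [m [nm mn ->]]; exists m, n; split=> //.
by rewrite !mulrA nm mul1r -mulrA nm mulr1.
Qed.

Lemma conjugate_trans (R : nzRingType) (r s t : R) :
  conjugate r s -> conjugate s t -> conjugate r t.
Proof.
case=> n [m [nm mn ->]] [n' [m' [nm' mn' ->]]]; exists (n * n'), (m' * m).
split; last by rewrite !mulrA.
  by rewrite mulrA -[n * n' * m']mulrA nm' mulr1.
by rewrite mulrA -[m' * m * n]mulrA mn mulr1.
Qed.

Lemma conjugate_rmorph (R : nzRingType) (S : comNzRingType)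
  (chi : {rmorphism R -> S}) (r s : R) : conjugate r s -> chi r = chi s.
Proof.
case=> n [m [nm _ ->]].
by rewrite !rmorphM mulrC mulrA -rmorphM nm rmorph1 mul1r.
Qed.

Lemma dihedral_involutions_nonconj (K : fieldType) (K2 : 2 != 0 :> K)
    (D : groupType) (a b : D) (hD : infinite_dihedral a b) (i j : 'I_6) :
  conjugate (tnth (dihedral_involutions K a b) i)
            (tnth (dihedral_involutions K a b) j) -> i = j.
Proof.
have exists_char (x y : K) : x * x = 1 -> y * y = 1 ->
    exists chi : {rmorphism group_algebra K D -> K},
      chi (of_group K a) = x /\ chi (of_group K b) = y.
  move=> xx yy; have [|chi [? ? _]] :=
    @dihedral_galg_lift K K D a b idfun x y hD _ xx yy.
    by move=> c z; apply: mulrC.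
  by exists chi.
have NN : -1 * -1 = 1 :> K by rewrite mulrNN mulr1.
(* The three characters take the values [(1, 1, 1)] on 1, [(1, 1, -1)] on [a] and [(1, -1, 1)] on
   [b]; with their opposites these are six distinct triples, as 1 differs from -1. *)
have [chi1 [chi1a chi1b]] := exists_char 1 1 (mulr1 1) (mulr1 1).
have [chi2 [chi2a chi2b]] := exists_char 1 (-1) (mulr1 1) NN.
have [chi3 [chi3a chi3b]] := exists_char (-1) 1 NN (mulr1 1).
have ne : 1 <> -1 :> K.
  by move/eqP; rewrite -subr_eq0 opprK -[1 + 1]/2 (negPf K2).
move=> H; move: (conjugate_rmorph chi1 H) (conjugate_rmorph chi2 H)
  (conjugate_rmorph chi3 H).
case: i j {H} => [[|[|[|[|[|[|//]]]]]] ?] [[|[|[|[|[|[|//]]]]]] ?];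
  rewrite !(tnth_nth 0) /= ?rmorphN ?rmorph1 ?chi1a ?chi1b ?chi2a ?chi2b
    ?chi3a ?chi3b ?opprK => E1 E2 E3; try exact: val_inj;
  by case: ne; rewrite // E1 // E2 // E3.
Qed.

Theorem theorem1 (K : closedFieldType) (charK : 2%N \notin [pchar K])
    (D : groupType) (a b : D) (hD : infinite_dihedral a b) :
  let c := dihedral_involutions K a b in
  [/\ forall i : 'I_6, involution (tnth c i),
      forall u : group_algebra K D, involution u ->
        exists! i : 'I_6, conjugate u (tnth c i)
    & forall i j : 'I_6, i != j -> ~ conjugate (tnth c i) (tnth c j)].
Proof.
have K2 : 2 != 0 :> K by move: charK; rewrite inE.
move=> c; split; last first.
- by move=> i j /eqP ij cij; apply: ij (dihedral_involutions_nonconj K2 hD cij).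
- move=> u; rewrite /involution expr2 => uu.
  suff [i ui] : exists i, conjugate u (tnth c i).
    exists i; split=> // j uj; apply: (dihedral_involutions_nonconj K2 hD).
    exact: conjugate_trans (conjugate_sym ui) uj.
  have [Phi [PhiA PhiB Phi_inj Phi_im]] := dihedral_galg_order K2 hD.
  (* The conjugating matrices have preimages under [Phi], and injectivity pulls the identities
     back. *)
  have conjP r : order_conj (Phi u) (Phi r) -> conjugate u r.
    case=> N [NV [/Phi_im[n <-] /Phi_im[m <-] nm mn ur]].
    exists n, m; split; apply: Phi_inj; rewrite ?rmorphM ?rmorph1 //.
  have cP k (k6 : (k < 6)%N) : conjugate u (nth 0 c k) ->
      exists i, conjugate u (tnth c i).
    by exists (Ordinal k6); rewrite (tnth_nth 0).
  have PhiU : in_order (Phi u) by apply/Phi_im; exists u.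
  have PhiUU : Phi u * Phi u = 1 by rewrite -rmorphM uu rmorph1.
  case: (order_involution K2 PhiU PhiUU) => [U1|U1|[]|[]].
  + apply: (cP 0%N) => //; rewrite (_ : u = 1); first exact: conjugate_refl.
    by apply: Phi_inj; rewrite U1 rmorph1.
  + apply: (cP 1%N) => //; rewrite (_ : u = -1); first exact: conjugate_refl.
    by apply: Phi_inj; rewrite U1 rmorphN rmorph1.
  + by rewrite -PhiA => /conjP; apply: (cP 2).
  + by rewrite -PhiA -rmorphN => /conjP; apply: (cP 3).
  + by rewrite -PhiB => /conjP; apply: (cP 4).
  + by rewrite -PhiB -rmorphN => /conjP; apply: (cP 5).
have [aa bb _] := hD.
have AA : of_group K a * of_group K a = 1 by exact: of_group_involution.
have BB : of_group K b * of_group K b = 1 by exact: of_group_involution.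
case=> [[|[|[|[|[|[|//]]]]]] ?]; rewrite /involution (tnth_nth 0) /= ?sqrrN;
  by rewrite ?expr1n // expr2.
Qed.
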